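(* Let $X_0:\Sigma\to\mathbb{M}^2(\kappa)\times\mathbb{R}$ be a helicoidal surface with pitch $b_0$ (space-like if $\varepsilon=-1$), let $(\tilde s,\tilde\theta)$ be its natural parameters and let $d\tilde s^2+U(\tilde s)^2\,d\tilde\theta^2$ be its induced metric. Then there exists a two-parameter family of isometric helicoidal surfaces parametrized by $X_{m,b}:\Sigma\to\mathbb{M}^2(\kappa)\times\mathbb{R}$, where $X_{m,b}$ has pitch $b$ and $X_0=X_{1,b_0}$, given in cylindrical coordinates by $X_{m,b}(\tilde s,\tilde\theta)=(\rho(\tilde s),\theta(\tilde s,\tilde\theta),t(\tilde s)+b\,\theta(\tilde s,\tilde\theta))$ with $$\rho(\tilde s)=\int\left(\frac{m^4U^2\dot U^2}{(m^2U^2-\varepsilon b^2)(1-\kappa(m^2U^2-\varepsilon b^2))}\right)^{1/2}d\tilde s,$$ $$t(\tilde s)=\int\left(\varepsilon\,\frac{(m^2U^2-\varepsilon b^2)(1-\kappa(m^2U^2-\varepsilon b^2))-m^4U^2\dot U^2}{1-\kappa(m^2U^2-\varepsilon b^2)}\right)^{1/2}\frac{mU}{m^2U^2-\varepsilon b^2}\,d\tilde s,$$ $$\theta(\tilde s,\tilde\theta)=\frac1m\tilde\theta-\varepsilon\int\frac{b}{mU(m^2U^2-\varepsilon b^2)}\left(\varepsilon\,\frac{(m^2U^2-\varepsilon b^2)(1-\kappa(m^2U^2-\varepsilon b^2))-m^4U^2\dot U^2}{1-\kappa(m^2U^2-\varepsilon b^2)}\right)^{1/2}d\tilde s,$$ and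 $\mathrm{sn}_\kappa^2(\rho)=m^2U^2-\varepsilon b^2$. Here $m\neq0$ and $b$ range over the values for which these expressions are defined (on a suitable interval of $\tilde s$), the signs of the square roots and the constants of integration are chosen suitably, with the same sign of the root in $t$ and in $\theta$.
   Context: Fix $\varepsilon\in\{1,-1\}$, $\kappa\in\mathbb{R}$. $\mathbb{M}^2(\kappa)$ is the simply connected complete surface of constant curvature $\kappa$ with metric $d\sigma^2$; $\mathbb{M}^2(\kappa)\times\mathbb{R}$ carries the metric $d\sigma^2+\varepsilon\,dt^2$. $(\rho,\theta)$ are polar coordinates centered at a point $p_0\in\mathbb{M}^2(\kappa)$ and $(\rho,\theta,t)$ the corresponding cylindrical coordinates. $\mathrm{sn}_\kappa(\rho)=|\partial_\theta|$, i.e. $\sin(\sqrt\kappa\rho)/\sqrt\kappa$, $\rho$, $\sinh(\sqrt{-\kappa}\rho)/\sqrt{-\kappa}$ for $\kappa>0$, $=0$, $<0$. A dot on $U$ denotes $d/d\tilde s$. A helicoidal (screw-motion invariant) surface with pitch $b$ and axis $\{p_0\}\times\mathbb{R}$ is one parametrized by $X(s,\theta)=(\rho(s),\theta,t(s)+b\theta)$ in cylindrical coordinates. For $\varepsilon=-1$ it is assumed space-like (induced metric Riemannian). With $W^2=\mathrm{sn}_\kappa^2(\rho)(\dot\rho^2+\varepsilon\dot t^2)+\varepsilon b^2\dot\rho^2$ (here dots are $d/ds$) and $U^2=\mathrm{sn}_\kappa^2(\rho)+\varepsilon b^2>0$, its natural parameters are (locally) defined by $d\tilde s=\frac{W}{U}\,ds$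 and $d\tilde\theta=d\theta+U^{-2}\varepsilon b\,\dot t\,ds$; the induced metric is then $d\tilde s^2+U^2d\tilde\theta^2$. The surfaces $X_{m,b}$ being isometric means that each has induced metric $d\tilde s^2+U^2d\tilde\theta^2$ with the same function $U(\tilde s)$. *)

(* Defs.v *)
From Stdlib Require Import Reals Lra.
From Coquelicot Require Import Coquelicot.
Open Scope R_scope.

Definition itv (a b : Rbar) (x : R) : Prop := Rbar_lt a x /\ Rbar_lt x b.

(* [I] is meant to be open. *)
Definition class_C (n : nat) (I : R -> Prop) (f : R -> R) : Prop :=
  forall x, I x ->
    (forall k, (k <= n)%nat -> ex_derive_n f k x) /\ continuous (Derive_n f n) x.

(* [sn kap rho] is the length of the coordinate field d/dtheta of the polar
   coordinates of M^2(kap), at distance [rho] from their centre. *)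
Definition sn (kap rho : R) : R :=
  if Rlt_dec 0 kap then sin (sqrt kap * rho) / sqrt kap
  else if Rlt_dec kap 0 then sinh (sqrt (- kap) * rho) / sqrt (- kap)
  else rho.

(* Cylindrical coordinates (rho, theta, t) of a point of M^2(kap) x R, or the
   components of a tangent vector in the coordinate frame.  The angle is a real
   number, not reduced modulo 2 pi. *)
Record cyl : Type := Cyl { crho : R; ctheta : R; ct : R }.

(* Radii at which polar coordinates are regular: the centre and, if kap > 0,
   its antipode are excluded. *)
Definition polar_radius (kap rho : R) : Prop :=
  0 < rho /\ (0 < kap -> rho < PI / sqrt kap).

(* The ambient metric dsigma^2 + eps dt^2, where
   dsigma^2 = drho^2 + sn_kap(rho)^2 dtheta^2, as a quadratic form at [p]. *)
Definition ambient_metric (eps kap : R) (p v : cyl) : R :=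
  crho v ^ 2 + sn kap (crho p) ^ 2 * ctheta v ^ 2 + eps * ct v ^ 2.

(* The vector dX_(x,y)(h, k). *)
Definition pushforward (X : R -> R -> cyl) (x y h k : R) : cyl :=
  let d (c : cyl -> R) :=
    h * Derive (fun x' => c (X x' y)) x + k * Derive (fun y' => c (X x y')) y in
  Cyl (d crho) (d ctheta) (d ct).

Definition induced_metric (eps kap : R) (X : R -> R -> cyl) (x y h k : R) : R :=
  ambient_metric eps kap (X x y) (pushforward X x y h k).

Definition screw (rho t : R -> R) (b s theta : R) : cyl :=
  Cyl (rho s) theta (t s + b * theta).

(* The last clause says that the induced metric is Riemannian: for eps = 1 this
   is the condition that the parametrization is an immersion, for eps = -1 that
   the surface is space-like. *)
Definition helicoidal (eps kap : R) (n : nat) (I : R -> Prop)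
    (rho t : R -> R) (b : R) : Prop :=
  class_C n I rho /\ class_C n I t /\
  (forall s, I s -> polar_radius kap (rho s)) /\
  (forall s theta h k, I s -> (h <> 0 \/ k <> 0) ->
     0 < induced_metric eps kap (screw rho t b) s theta h k).

Definition profile_U (eps kap : R) (rho : R -> R) (b s : R) : R :=
  sqrt (sn kap (rho s) ^ 2 + eps * b ^ 2).

Definition profile_W (eps kap : R) (rho t : R -> R) (b s : R) : R :=
  sqrt (sn kap (rho s) ^ 2 * (Derive rho s ^ 2 + eps * Derive t s ^ 2)
        + eps * b ^ 2 * Derive rho s ^ 2).

(* The natural parameters of [screw rho t b] at (s, theta) are
   (sig s, theta + tau s); [U] is the function of the first of them for which
   the induced metric is dsig^2 + U^2 d(theta + tau)^2. *)
Definition natural_parameters (eps kap : R) (I : R -> Prop)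
    (rho t : R -> R) (b : R) (sig tau U : R -> R) : Prop :=
  forall s, I s ->
    is_derive sig s (profile_W eps kap rho t b s / profile_U eps kap rho b s) /\
    is_derive tau s (eps * b * Derive t s / profile_U eps kap rho b s ^ 2) /\
    U (sig s) = profile_U eps kap rho b s.

Definition bourQ (eps : R) (U : R -> R) (m b x : R) : R :=
  m ^ 2 * U x ^ 2 - eps * b ^ 2.

Definition rho_radicand (eps kap : R) (U : R -> R) (m b x : R) : R :=
  let Q := bourQ eps U m b x in
  m ^ 4 * U x ^ 2 * Derive U x ^ 2 / (Q * (1 - kap * Q)).

Definition t_radicand (eps kap : R) (U : R -> R) (m b x : R) : R :=
  let Q := bourQ eps U m b x in
  eps * ((Q * (1 - kap * Q) - m ^ 4 * U x ^ 2 * Derive U x ^ 2) / (1 - kap * Q)).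

(* The parameters for which the expressions for rho, t and theta make sense on
   [J]: denominators do not vanish and radicands are nonnegative.  The signs of
   [bourQ] and [1 - kap * bourQ] are forced, since these are to be the squares
   of sn_kap(rho) and of its derivative in rho; [rho_radicand] is then
   automatically nonnegative. *)
Definition admissible (eps kap : R) (U : R -> R) (J : R -> Prop) (m b : R) : Prop :=
  m <> 0 /\
  forall x, J x ->
    0 < bourQ eps U m b x /\ 0 < 1 - kap * bourQ eps U m b x /\
    0 <= t_radicand eps kap U m b x.

(* A choice of sign at each point: a continuous square root may change sign
   where its radicand vanishes. *)
Definition sign_on (J : R -> Prop) (f : R -> R) : Prop :=
  forall x, J x -> f x = 1 \/ f x = -1.

(* Main.v *)
(** If the induced metric of a surface of pitch b, with angle theta = y / m + psi(x),
    is dx^2 + U^2 dy^2, the coefficient of dy^2 forces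
    sn(rho)^2 = m^2 U^2 - eps b^2 =: Q; the vanishing cross term and the coefficient
    of dx^2 then determine t' and psi' up to a common sign.  Conversely, taking
    rho with sn(rho) = sqrt Q and primitives for t and psi, the metric identity is a
    pointwise computation.  The original surface is itself the member
    (m, b) = (1, b0), after reparametrization by the inverse of the natural
    parameter. *)

(* Two obstacles shape the proof. For kap > 0, sn is not injective on the allowed radii: sn(rho) =
   sqrt Q can be solved on either side of the equator, where the derivative cs of sn vanishes. The
   constructed surfaces take the branch next to the axis, on which cs > 0. The original surface may
   lie on the other branch, and its derivatives may change sign, so it is kept as given and the
   signs of the roots are read off from it point by point. The second obstacle is regularity. A
   square root is only continuous where its radicand vanishes, so t and phi are C^1 in general, and
   of higher class when the radicand of t is positive. No order is lost on the way: W contains first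
   derivatives of the profile and the radicands contain U', but each such loss is repaid by an
   integration, or by the passage from sig' to sig. *)
Require Import Defs.
From Stdlib Require Import Reals Lra Lia Classical ClassicalEpsilon.
From Coquelicot Require Import Coquelicot.
Open Scope R_scope.

(** * Functions of class C^n on open sets *)

Lemma open_itv (a b : Rbar) : open (itv a b).
Proof. apply open_and; [apply open_Rbar_gt | apply open_Rbar_lt]. Qed.

Lemma is_derive_eq (f : R -> R) (x l l' : R) :
  is_derive f x l -> l = l' -> is_derive f x l'.
Proof. now intros H <-. Qed.

Lemma is_derive_ext_on (I : R -> Prop) (f g : R -> R) (x l : R) :
  open I -> (forall y, I y -> f y = g y) -> I x -> is_derive f x l -> is_derive g x l.
Proof.
intros oI fg Ix. apply is_derive_ext_loc.
apply (filter_imp I); [exact fg | now apply oI].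
Qed.

Lemma continuous_of_derive (f : R -> R) (x l : R) : is_derive f x l -> continuous f x.
Proof. intros H. apply (ex_derive_continuous f). now exists l. Qed.

Lemma class_C_ext (n : nat) (I : R -> Prop) (f g : R -> R) :
  open I -> (forall x, I x -> f x = g x) -> class_C n I f -> class_C n I g.
Proof.
intros oI fg Cf x Ix.
assert (L : locally x (fun y => f y = g y)).
{ apply (filter_imp I); [exact fg | now apply oI]. }
destruct (Cf x Ix) as [E C]. split.
- intros k kn. apply (ex_derive_n_ext_loc f g); auto.
- apply (continuous_ext_loc _ (Derive_n f n)); [|exact C].
  apply (filter_imp I); [|now apply oI].
  intros y Iy. apply Derive_n_ext_loc.
  apply (filter_imp I); [exact fg | now apply oI].
Qed.

Lemma class_C_0 (I : R -> Prop) (f : R -> R) :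
  (forall x, I x -> continuous f x) -> class_C 0 I f.
Proof.
intros C x Ix. split; [|exact (C x Ix)].
intros k k0. replace k with 0%nat by lia. exact Logic.I.
Qed.

(** Splitting off the first derivative, not the last, makes the calculus rules provable by induction
    on [n]: the derivative of a product or a composite is again built from functions of one class
    lower. *)
Lemma class_C_Derive (n : nat) (I : R -> Prop) (f : R -> R) :
  class_C (S n) I f <->
  (forall x, I x -> ex_derive f x) /\ class_C n I (Derive f).
Proof.
assert (D : forall k x, Derive_n (Derive f) k x = Derive_n f (S k) x).
{ intros k x. change (Derive f) with (Derive_n f 1).
  rewrite Derive_n_comp. now replace (k + 1)%nat with (S k) by lia. }
split.
- intros Cf. split.
  + intros x Ix. apply (proj1 (Cf x Ix) 1%nat). lia.
  + intros x Ix. destruct (Cf x Ix) as [E C]. split.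
    * intros [|k] kn; [exact Logic.I|].
      apply (ex_derive_ext (Derive_n f (S k))); [intros; now rewrite D|].
      apply (E (S (S k))). lia.
    * apply (continuous_ext (Derive_n f (S n))); [intros; now rewrite D | exact C].
- intros [Ef Cf] x Ix. destruct (Cf x Ix) as [E C]. split.
  + intros [|[|k]] kn; [exact Logic.I | exact (Ef x Ix) |].
    apply (ex_derive_ext (Derive_n (Derive f) k)); [intros; now rewrite D|].
    apply (E (S k)). lia.
  + apply (continuous_ext (Derive_n (Derive f) n)); [intros; now rewrite D | exact C].
Qed.

Lemma class_C_S (n : nat) (I : R -> Prop) (f f' : R -> R) :
  open I -> (forall x, I x -> is_derive f x (f' x)) -> class_C n I f' ->
  class_C (S n) I f.
Proof.
intros oI Df Cf'. apply class_C_Derive. split.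
- intros x Ix. exists (f' x). auto.
- apply (class_C_ext n I f'); auto.
  intros x Ix. symmetry. now apply is_derive_unique, Df.
Qed.

Lemma class_C_is_derive (n : nat) (I : R -> Prop) (f : R -> R) (x : R) :
  class_C (S n) I f -> I x -> is_derive f x (Derive f x).
Proof. intros Cf Ix. apply Derive_correct. now apply (proj1 (class_C_Derive n I f)). Qed.

Lemma class_C_pred (n : nat) (I : R -> Prop) (f : R -> R) :
  class_C (S n) I f -> class_C n I f.
Proof.
intros Cf x Ix. destruct (Cf x Ix) as [E _]. split.
- intros k kn. apply E. lia.
- apply (ex_derive_continuous (Derive_n f n)). apply (E (S n)). lia.
Qed.

Lemma class_C_continuous (n : nat) (I : R -> Prop) (f : R -> R) (x : R) :
  class_C n I f -> I x -> continuous f x.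
Proof.
intros Cf Ix. induction n as [|n IH].
- exact (proj2 (Cf x Ix)).
- now apply IH, class_C_pred.
Qed.

Lemma class_C_const (n : nat) (I : R -> Prop) (c : R) : open I -> class_C n I (fun _ => c).
Proof.
intros oI. revert c. induction n as [|n IH]; intros c.
- apply class_C_0. intros. apply continuous_const.
- apply (class_C_S n I _ (fun _ => 0)); auto. intros. auto_derive; auto.
Qed.

Lemma class_C_plus (n : nat) (I : R -> Prop) (f g : R -> R) :
  open I -> class_C n I f -> class_C n I g -> class_C n I (fun x => f x + g x).
Proof.
intros oI. revert f g. induction n as [|n IH]; intros f g Cf Cg.
- apply class_C_0. intros x Ix.
  apply (continuous_plus f g); eapply class_C_continuous; eauto.
- apply (class_C_S n I _ (fun x => Derive f x + Derive g x)); auto.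
  + intros x Ix. apply (is_derive_plus f g); eapply class_C_is_derive; eauto.
  + apply IH; now apply class_C_Derive.
Qed.

Lemma class_C_mult (n : nat) (I : R -> Prop) (f g : R -> R) :
  open I -> class_C n I f -> class_C n I g -> class_C n I (fun x => f x * g x).
Proof.
intros oI. revert f g. induction n as [|n IH]; intros f g Cf Cg.
- apply class_C_0. intros x Ix.
  apply (continuous_mult f g); eapply class_C_continuous; eauto.
- apply (class_C_S n I _ (fun x => Derive f x * g x + f x * Derive g x)); auto.
  + intros x Ix. apply (is_derive_mult f g); [eapply class_C_is_derive; eauto .. |].
    exact Rmult_comm.
  + apply class_C_plus; auto; apply IH; try (now apply class_C_pred);
      now apply class_C_Derive.
Qed.

Lemma class_C_minus (n : nat) (I : R -> Prop) (f g : R -> R) :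
  open I -> class_C n I f -> class_C n I g -> class_C n I (fun x => f x - g x).
Proof.
intros oI Cf Cg.
apply (class_C_ext n I (fun x => f x + (-1) * g x)); [exact oI | intros; ring |].
apply class_C_plus, class_C_mult; auto. now apply class_C_const.
Qed.

Lemma class_C_pow (n : nat) (I : R -> Prop) (f : R -> R) (k : nat) :
  open I -> class_C n I f -> class_C n I (fun x => f x ^ k).
Proof.
intros oI Cf. induction k as [|k IH]; simpl.
- now apply class_C_const.
- now apply class_C_mult.
Qed.

Lemma class_C_comp (n : nat) (I J : R -> Prop) (g f : R -> R) :
  open I -> open J -> (forall x, J x -> I (f x)) ->
  class_C n I g -> class_C n J f -> class_C n J (fun x => g (f x)).
Proof.
intros oI oJ fJ. revert g. induction n as [|n IH]; intros g Cg Cf.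
- apply class_C_0. intros x Jx.
  apply (continuous_comp f g); eapply class_C_continuous; eauto.
- apply (class_C_S n J _ (fun x => Derive f x * Derive g (f x))); auto.
  + intros x Jx. apply (is_derive_comp g f); eapply class_C_is_derive; eauto.
  + apply class_C_mult; auto; [now apply class_C_Derive|].
    apply IH; [now apply class_C_Derive | now apply class_C_pred].
Qed.

Lemma class_C_inv (n : nat) (I : R -> Prop) (f : R -> R) :
  open I -> (forall x, I x -> f x <> 0) -> class_C n I f -> class_C n I (fun x => / f x).
Proof.
intros oI f0. induction n as [|n IH]; intros Cf.
- apply class_C_0. intros x Ix.
  apply continuous_Rinv_comp; [eapply class_C_continuous|]; eauto.
(* The derivative is written through [/ f] itself, so that the induction hypothesis covers it. *)
- apply (class_C_S n I _ (fun x => (-1) * Derive f x * (/ f x) ^ 2)); auto.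
  + intros x Ix. eapply is_derive_eq.
    { apply is_derive_inv; [eapply class_C_is_derive|]; eauto. }
    field. auto.
  + apply class_C_mult; [exact oI| |].
    * apply class_C_mult; [exact oI | now apply class_C_const | now apply class_C_Derive].
    * apply class_C_pow; auto using class_C_pred.
Qed.

Lemma class_C_div (n : nat) (I : R -> Prop) (f g : R -> R) :
  open I -> (forall x, I x -> g x <> 0) ->
  class_C n I f -> class_C n I g -> class_C n I (fun x => f x / g x).
Proof. intros. apply class_C_mult; auto. now apply class_C_inv. Qed.

Lemma class_C_sqrt (n : nat) (I : R -> Prop) (f : R -> R) :
  open I -> (forall x, I x -> 0 < f x) -> class_C n I f -> class_C n I (fun x => sqrt (f x)).
Proof.
intros oI f0. induction n as [|n IH]; intros Cf.
- apply class_C_0. intros x Ix.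
  apply continuous_sqrt_comp. eapply class_C_continuous; eauto.
- apply (class_C_S n I _ (fun x => Derive f x / (2 * sqrt (f x)))); auto.
  + intros x Ix. apply is_derive_sqrt; [eapply class_C_is_derive|]; eauto.
  + apply class_C_div; auto.
    * intros x Ix. specialize (f0 x Ix). apply sqrt_lt_R0 in f0. lra.
    * now apply class_C_Derive.
    * apply class_C_mult; [exact oI | now apply class_C_const|].
      now apply IH, class_C_pred.
Qed.

(** * Right inverses of an increasing differentiable function *)

Section InverseFunction.

Context (a b : Rbar) (J : R -> Prop) (f f' g : R -> R).
Hypothesis oJ : open J.
Hypothesis Df : forall x, itv a b x -> is_derive f x (f' x).
Hypothesis f'_pos : forall x, itv a b x -> 0 < f' x.
Hypothesis gI : forall y, J y -> itv a b (g y).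
Hypothesis fg : forall y, J y -> f (g y) = y.

Lemma incr_on_itv (x y : R) : itv a b x -> itv a b y -> x < y -> f x < f y.
Proof.
intros [ax _] [_ yb] xy.
apply (incr_function f a b f'); auto.
- intros z az zb. apply Df. now split.
- intros z az zb. apply f'_pos. now split.
Qed.

Lemma inj_on_itv (x y : R) : itv a b x -> itv a b y -> f x = f y -> x = y.
Proof.
intros Ix Iy e. destruct (Rtotal_order x y) as [l|[q|l]]; auto.
- assert (K := incr_on_itv x y Ix Iy l). lra.
- assert (K := incr_on_itv y x Iy Ix l). lra.
Qed.

(** Monotonicity traps the values: if z lies between f (g y - r) and f (g y + r), then g z lies
    between g y - r and g y + r. The radius r is small enough to stay in the domain of f and below
    the tolerance. *)
Lemma continuous_inverse (y : R) : J y -> continuous g y.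
Proof.
intros Jy. apply filterlim_locally. intros e.
destruct (open_itv a b (g y) (gI y Jy)) as [d Hd].
set (r := Rmin e d / 2).
assert (r0 : 0 < r /\ r < e /\ r < d).
{ assert (0 < Rmin e d) by (apply Rmin_glb_lt; apply cond_pos).
  assert (A1 := Rmin_l e d). assert (A2 := Rmin_r e d). unfold r. lra. }
assert (Hball : forall z, Rabs (z - g y) < d -> itv a b z).
{ intros z Hz. apply Hd. exact Hz. }
assert (I1 : itv a b (g y - r)).
{ apply Hball. replace (g y - r - g y) with (- r) by ring.
  rewrite Rabs_Ropp, Rabs_pos_eq; lra. }
assert (I2 : itv a b (g y + r)).
{ apply Hball. replace (g y + r - g y) with r by ring. rewrite Rabs_pos_eq; lra. }
assert (L1 : f (g y - r) < y).
{ rewrite <- (fg y Jy) at 2. apply incr_on_itv; auto. lra. }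
assert (L2 : y < f (g y + r)).
{ rewrite <- (fg y Jy) at 1. apply incr_on_itv; auto. lra. }
assert (L : locally y (fun z => J z /\ f (g y - r) < z < f (g y + r))).
{ apply filter_and; [now apply oJ|].
  apply (open_and _ _ (open_gt _) (open_lt _)). now split. }
revert L. apply filter_imp. intros z [Jz [z1 z2]].
assert (g y - r < g z).
{ apply Rnot_le_lt. intros [l|q].
  - assert (K := incr_on_itv _ _ (gI z Jz) I1 l). rewrite fg in K; auto. lra.
  - rewrite <- q, fg in z1; auto. lra. }
assert (g z < g y + r).
{ apply Rnot_le_lt. intros [l|q].
  - assert (K := incr_on_itv _ _ I2 (gI z Jz) l). rewrite fg in K; auto. lra.
  - rewrite q, fg in z2; auto. lra. }
change (Rabs (g z - g y) < e). apply Rabs_def1; lra.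
Qed.

Lemma is_derive_inverse (y : R) : J y -> is_derive g y (/ f' (g y)).
Proof.
intros Jy. set (l := f' (g y)).
assert (l0 : 0 < l) by (apply f'_pos, gI, Jy).
split; [apply is_linear_scal_l|].
intros y' Hy'. rewrite <- (is_filter_lim_locally_unique y y' Hy'). clear y' Hy'.
intros e.
(* With H = z - y and D = g z - g y, differentiability of f gives |H - D l| <= d |D|, and the goal
   is |H - D l| <= e l |H|. The bound d <= l / 2 yields |D| <= 2 |H| / l; then d <= e l^2 / 2 turns
   d |D| into at most e l |H|. *)
assert (d0 : 0 < Rmin (l / 2) (e * l ^ 2 / 2)).
{ assert (e0 := cond_pos e). apply Rmin_glb_lt; [lra|].
  assert (0 < e * l ^ 2) by (apply Rmult_lt_0_compat; [|apply pow_lt]; lra). lra. }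
set (d := mkposreal _ d0).
assert (d1 : d <= l / 2) by apply Rmin_l.
assert (d2 : d <= e * l ^ 2 / 2) by apply Rmin_r. clearbody d.
destruct (Df (g y) (gI y Jy)) as [_ F].
specialize (F (g y) (fun P H => H) d).
assert (C := continuous_inverse y Jy). specialize (C _ F). unfold filtermap in C.
assert (L := filter_and _ _ C (oJ y Jy)).
revert L. apply filter_imp. intros z [Hz Jz]. revert Hz.
unfold minus, plus, opp, scal, norm; simpl. unfold mult, abs; simpl.
rewrite !fg by assumption. fold l.
replace (z + - y + - ((g z + - g y) * l)) with ((z - y) - (g z - g y) * l) by ring.
replace (g z + - g y + - ((z + - y) * / l))
  with (- ((z - y) - (g z - g y) * l) * / l) by (field; lra).
change (z + - y) with (z - y). change (g z + - g y) with (g z - g y).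
intros B.
rewrite Rabs_mult, Rabs_Ropp, (Rabs_pos_eq (/ l)) by (left; now apply Rinv_0_lt_compat).
set (H := z - y) in *. set (D := g z - g y) in *.
(* The bound on [H - D l] first gives [|D| <= 2 |H| / l]. *)
assert (B1 : Rabs D * l <= Rabs H + d * Rabs D).
{ rewrite <- (Rabs_pos_eq l) at 1 by lra. rewrite <- Rabs_mult.
  replace (D * l) with (H - (H - D * l)) by ring.
  eapply Rle_trans; [apply Rabs_triang|]. rewrite Rabs_Ropp. lra. }
assert (D0 := Rabs_pos D).
assert (B2 : d * Rabs D <= e * l * Rabs H).
{ apply Rle_trans with (e * l / 2 * (Rabs D * l)).
  - replace (e * l / 2 * (Rabs D * l)) with (e * l ^ 2 / 2 * Rabs D) by field.
    now apply Rmult_le_compat_r.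
  - replace (e * l * Rabs H) with (e * l / 2 * (2 * Rabs H)) by field.
    apply Rmult_le_compat_l.
    + assert (e0 := cond_pos e).
      assert (0 < e * l) by (apply Rmult_lt_0_compat; lra). lra.
    + assert (d * Rabs D <= l / 2 * Rabs D) by now apply Rmult_le_compat_r. lra. }
apply Rmult_le_reg_r with l; [exact l0|].
rewrite Rmult_assoc, Rinv_l, Rmult_1_r by lra. lra.
Qed.

(** Bootstrapping: g' = 1 / f'(g) is as regular as g, as far as f' allows, so every pass gains one
    order for g. It starts from mere continuity. *)
Lemma class_C_inverse (n : nat) : class_C n (itv a b) f' -> class_C (S n) J g.
Proof.
induction n as [|n IH]; intros Cf'.
all: apply (class_C_S _ J g (fun y => / f' (g y)) oJ is_derive_inverse).
all: apply class_C_inv; [exact oJ | intros y Jy; assert (K := f'_pos _ (gI y Jy)); lra |].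
all: apply (class_C_comp _ (itv a b) J f' g); auto using open_itv.
- apply class_C_0. exact continuous_inverse.
- now apply IH, class_C_pred.
Qed.

End InverseFunction.

(** An interval contains the segment from a base point to any of its points, so the integral from
    there exists. If there is no base point, there is nothing to prove. *)
Lemma primitive_on_itv (a b : Rbar) (f : R -> R) :
  (forall x, itv a b x -> continuous f x) ->
  exists F, forall x, itv a b x -> is_derive F x (f x).
Proof.
intros Cf. destruct (classic (exists x0, itv a b x0)) as [[x0 I0]|N].
- exists (RInt f x0). intros x Ix.
  apply (is_derive_RInt f (RInt f x0) x0); [|now apply Cf].
  apply (filter_imp (itv a b)); [|now apply open_itv].
  intros y Iy. apply (RInt_correct f x0 y), ex_RInt_continuous.
  intros z [z1 z2]. apply Cf. split.
  + apply Rbar_lt_le_trans with (Rmin x0 y); [|exact z1].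
    apply Rmin_case; [apply I0 | apply Iy].
  + apply Rbar_le_lt_trans with (Rmax x0 y); [exact z2|].
    apply Rmax_case; [apply I0 | apply Iy].
- exists f. intros x Ix. destruct N. now exists x.
Qed.

(** * The function sn and its inverse *)

(** The derivative of [sn kap]. Once sn(rho)^2 = Q, the factor 1 - kap Q in the radicands is its
    square. *)
Definition cs (kap rho : R) : R :=
  if Rlt_dec 0 kap then cos (sqrt kap * rho)
  else if Rlt_dec kap 0 then cosh (sqrt (- kap) * rho)
  else 1.

Lemma cs_sn (kap x : R) : cs kap x ^ 2 = 1 - kap * sn kap x ^ 2.
Proof.
unfold cs, sn. destruct (Rlt_dec 0 kap) as [p|p]; [|destruct (Rlt_dec kap 0) as [q|q]].
- assert (r := sqrt_lt_R0 _ p). assert (e := sqrt_sqrt kap (Rlt_le _ _ p)).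
  rewrite <- e at 2.
  assert (K := sin2_cos2 (sqrt kap * x)). unfold Rsqr in K.
  replace (sqrt kap * sqrt kap * (sin (sqrt kap * x) / sqrt kap) ^ 2)
    with (sin (sqrt kap * x) ^ 2) by (field; lra). lra.
- assert (r := sqrt_lt_R0 (- kap) ltac:(lra)).
  assert (e := sqrt_sqrt (- kap) ltac:(lra)).
  assert (K : cosh (sqrt (- kap) * x) ^ 2 = 1 + sinh (sqrt (- kap) * x) ^ 2).
  { unfold cosh, sinh. rewrite exp_Ropp. field. apply Rgt_not_eq, exp_pos. }
  replace kap with (- (sqrt (- kap) * sqrt (- kap))) at 2 by lra.
  replace (- (sqrt (- kap) * sqrt (- kap)) * (sinh (sqrt (- kap) * x) / sqrt (- kap)) ^ 2)
    with (- sinh (sqrt (- kap) * x) ^ 2) by (field; lra). lra.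
- assert (e : kap = 0) by lra. rewrite e. ring.
Qed.

Lemma is_derive_sn (kap x : R) : is_derive (sn kap) x (cs kap x).
Proof.
unfold cs, sn. destruct (Rlt_dec 0 kap) as [p|p]; [|destruct (Rlt_dec kap 0) as [q|q]].
- assert (r := sqrt_lt_R0 _ p). auto_derive; [exact Logic.I | field; lra].
- assert (r := sqrt_lt_R0 (- kap) ltac:(lra)).
  unfold sinh, cosh. auto_derive; [exact Logic.I | field; lra].
- auto_derive; [exact Logic.I | ring].
Qed.

Lemma is_derive_cs (kap x : R) : is_derive (cs kap) x (- kap * sn kap x).
Proof.
unfold cs, sn. destruct (Rlt_dec 0 kap) as [p|p]; [|destruct (Rlt_dec kap 0) as [q|q]].
- assert (r := sqrt_lt_R0 _ p).
  apply is_derive_eq with (- sqrt kap * sin (sqrt kap * x)).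
  + auto_derive; [exact Logic.I | ring].
  + apply Rmult_eq_reg_r with (sqrt kap); [field_simplify; [|lra]|lra].
    rewrite pow2_sqrt by lra. ring.
- assert (r := sqrt_lt_R0 (- kap) ltac:(lra)).
  apply is_derive_eq with (sqrt (- kap) * sinh (sqrt (- kap) * x)).
  + unfold sinh, cosh. auto_derive; [exact Logic.I | field; lra].
  + apply Rmult_eq_reg_r with (sqrt (- kap)); [field_simplify; [|lra]|lra].
    rewrite pow2_sqrt by lra. ring.
- assert (e : kap = 0) by lra. rewrite e. auto_derive; [exact Logic.I | ring].
Qed.

(** Each function is, up to a constant, the derivative of the other, whence the simultaneous
    induction. *)
Lemma class_C_sn_cs (n : nat) (kap : R) :
  class_C n (fun _ => True) (sn kap) /\ class_C n (fun _ => True) (cs kap).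
Proof.
induction n as [|n [IHs IHc]].
- split; apply class_C_0; intros x _; eapply continuous_of_derive;
    [apply is_derive_sn | apply is_derive_cs].
- split.
  + apply (class_C_S n _ _ (cs kap)); [apply open_true | intros; apply is_derive_sn | exact IHc].
  + apply (class_C_S n _ _ (fun x => - kap * sn kap x));
      [apply open_true | intros; apply is_derive_cs |].
    apply class_C_mult; [apply open_true | apply class_C_const, open_true | exact IHs].
Qed.

Lemma sn_pos (kap x : R) : polar_radius kap x -> 0 < sn kap x.
Proof.
intros [x0 xk]. unfold sn.
destruct (Rlt_dec 0 kap) as [p|p]; [|destruct (Rlt_dec kap 0) as [q|q]].
- assert (r := sqrt_lt_R0 _ p). specialize (xk p).
  apply Rdiv_lt_0_compat; [|exact r]. apply sin_gt_0.
  + now apply Rmult_lt_0_compat.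
  + apply Rmult_lt_reg_r with (/ sqrt kap); [now apply Rinv_0_lt_compat|].
    replace (sqrt kap * x * / sqrt kap) with x by (field; lra). exact xk.
- assert (r := sqrt_lt_R0 (- kap) ltac:(lra)).
  apply Rdiv_lt_0_compat; [|exact r]. rewrite <- sinh_0. apply sinh_lt.
  now apply Rmult_lt_0_compat.
- exact x0.
Qed.

(* End of the interval of radii, starting at 0, on which [sn kap] is increasing. *)
Definition quarter (kap : R) : Rbar :=
  if Rlt_dec 0 kap then Finite (PI / 2 / sqrt kap) else p_infty.

Lemma polar_radius_quarter (kap x : R) : itv 0 (quarter kap) x -> polar_radius kap x.
Proof.
unfold itv, quarter. intros [x0 xq]. split; [exact x0|]. intros p.
destruct (Rlt_dec 0 kap) as [_|]; [|easy]. assert (r := sqrt_lt_R0 _ p).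
simpl in xq. apply Rlt_trans with (1 := xq).
apply Rmult_lt_compat_r; [now apply Rinv_0_lt_compat|]. assert (K := PI_RGT_0). lra.
Qed.

Lemma cs_pos (kap x : R) : itv 0 (quarter kap) x -> 0 < cs kap x.
Proof.
unfold itv, quarter, cs. simpl. intros [x0 xq].
destruct (Rlt_dec 0 kap) as [p|p]; [|destruct (Rlt_dec kap 0) as [q|q]].
- assert (r := sqrt_lt_R0 _ p). simpl in xq. apply cos_gt_0.
  + apply Rlt_trans with 0; [assert (K := PI_RGT_0); lra|]. now apply Rmult_lt_0_compat.
  + apply Rmult_lt_reg_r with (/ sqrt kap); [now apply Rinv_0_lt_compat|].
    replace (sqrt kap * x * / sqrt kap) with x by (field; lra). exact xq.
- unfold cosh. assert (K1 := exp_pos (sqrt (- kap) * x)).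
  assert (K2 := exp_pos (- (sqrt (- kap) * x))). lra.
- lra.
Qed.

Definition arcsn (kap q : R) : R :=
  if Rlt_dec 0 kap then asin (sqrt kap * q) / sqrt kap
  else if Rlt_dec kap 0 then arcsinh (sqrt (- kap) * q) / sqrt (- kap)
  else q.

(** The image of the increasing branch of [sn kap], written with a square so that admissibility says
    exactly that sqrt Q lies in it. *)
Definition sn_range (kap q : R) : Prop := 0 < q /\ 0 < 1 - kap * q ^ 2.

Lemma open_sn_range (kap : R) : open (sn_range kap).
Proof.
apply open_and; [apply open_gt|].
apply (open_comp (fun q => 1 - kap * q ^ 2) (fun z => 0 < z)); [|apply open_gt].
intros q _. apply (ex_derive_continuous (fun q => 1 - kap * q ^ 2)). auto_derive. auto.
Qed.

Lemma sn_arcsn (kap q : R) :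
  sn_range kap q -> itv 0 (quarter kap) (arcsn kap q) /\ sn kap (arcsn kap q) = q.
Proof.
intros [q0 q1]. unfold itv, arcsn, quarter, sn.
destruct (Rlt_dec 0 kap) as [p|p]; [|destruct (Rlt_dec kap 0) as [k|k]].
- assert (r := sqrt_lt_R0 _ p). assert (e := sqrt_sqrt kap (Rlt_le _ _ p)).
  assert (z0 : 0 < sqrt kap * q) by now apply Rmult_lt_0_compat.
  assert (z1 : sqrt kap * q < 1).
  { replace (kap * q ^ 2) with ((sqrt kap * q) ^ 2) in q1 by (rewrite <- e at 2; ring).
    nra. }
  assert (B := asin_bound_lt (sqrt kap * q) ltac:(lra)).
  repeat split; simpl.
  (* A nonpositive arcsine would have an opposite in [0, PI / 2), whose sine is nonnegative; this
     contradicts sqrt kap * q > 0. *)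
  + apply Rdiv_lt_0_compat; [|exact r]. apply Rnot_le_lt. intros N.
    assert (S := sin_asin (sqrt kap * q) ltac:(lra)).
    assert (K' := sin_ge_0 (- asin (sqrt kap * q)) ltac:(lra) ltac:(lra)).
    rewrite sin_neg in K'. lra.
  + apply Rmult_lt_compat_r; [now apply Rinv_0_lt_compat | lra].
  + replace (sqrt kap * (asin (sqrt kap * q) / sqrt kap)) with (asin (sqrt kap * q))
      by (field; lra).
    rewrite sin_asin by lra. field. lra.
- assert (r := sqrt_lt_R0 (- kap) ltac:(lra)).
  repeat split; simpl.
  + apply Rdiv_lt_0_compat; [|exact r]. rewrite <- (arcsinh_sinh 0), sinh_0.
    apply arcsinh_lt. now apply Rmult_lt_0_compat.
  + replace (sqrt (- kap) * (arcsinh (sqrt (- kap) * q) / sqrt (- kap)))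
      with (arcsinh (sqrt (- kap) * q)) by (field; lra).
    rewrite sinh_arcsinh. field. lra.
- now repeat split.
Qed.

Lemma is_derive_arcsn (kap q : R) :
  sn_range kap q -> is_derive (arcsn kap) q (/ cs kap (arcsn kap q)).
Proof.
apply (is_derive_inverse 0 (quarter kap) (sn_range kap) (sn kap) (cs kap) (arcsn kap)).
- apply open_sn_range.
- intros. apply is_derive_sn.
- apply cs_pos.
- intros y Hy. now apply sn_arcsn.
- intros y Hy. now apply sn_arcsn.
Qed.

Lemma class_C_arcsn (n : nat) (kap : R) : class_C n (sn_range kap) (arcsn kap).
Proof.
apply class_C_pred.
apply (class_C_inverse 0 (quarter kap) (sn_range kap) (sn kap) (cs kap) (arcsn kap)).
- apply open_sn_range.
- intros. apply is_derive_sn.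
- apply cs_pos.
- intros y Hy. now apply sn_arcsn.
- intros y Hy. now apply sn_arcsn.
- intros x _. now apply (proj2 (class_C_sn_cs n kap)).
Qed.

(** * The induced metric *)

(** The value at 0 is 1 rather than 0, since [sign_on] admits only 1 and -1. *)
Definition sgn (z : R) : R := if Rle_dec 0 z then 1 else -1.

Lemma sgn_cases (z : R) : sgn z = 1 \/ sgn z = -1.
Proof. unfold sgn. destruct (Rle_dec 0 z); auto. Qed.

(** Reduces each integral formula to recognizing its radicand as the square of a derivative already
    known. *)
Lemma sgn_sqrt (z p : R) : p = z ^ 2 -> sgn z * sqrt p = z.
Proof.
intros ->. replace (z ^ 2) with (Rsqr z) by (unfold Rsqr; ring).
rewrite sqrt_Rsqr_abs. unfold sgn. destruct (Rle_dec 0 z).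
- rewrite Rabs_pos_eq; lra.
- rewrite Rabs_left; lra.
Qed.

Lemma induced_metric_eq (eps kap : R) (X : R -> R -> cyl) (x y h k rx ry ax ay tx ty : R) :
  is_derive (fun x' : R => crho (X x' y)) x rx -> is_derive (fun y' : R => crho (X x y')) y ry ->
  is_derive (fun x' : R => ctheta (X x' y)) x ax ->
  is_derive (fun y' : R => ctheta (X x y')) y ay ->
  is_derive (fun x' : R => ct (X x' y)) x tx -> is_derive (fun y' : R => ct (X x y')) y ty ->
  induced_metric eps kap X x y h k =
  (h * rx + k * ry) ^ 2 + sn kap (crho (X x y)) ^ 2 * (h * ax + k * ay) ^ 2
  + eps * (h * tx + k * ty) ^ 2.
Proof.
intros H1 H2 H3 H4 H5 H6. unfold induced_metric, ambient_metric, pushforward; simpl.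
rewrite (is_derive_unique _ _ _ H1), (is_derive_unique _ _ _ H2),
  (is_derive_unique _ _ _ H3), (is_derive_unique _ _ _ H4),
  (is_derive_unique _ _ _ H5), (is_derive_unique _ _ _ H6).
reflexivity.
Qed.

Lemma induced_metric_screw (eps kap : R) (rho t : R -> R) (b s theta h k r1 t1 : R) :
  is_derive rho s r1 -> is_derive t s t1 ->
  induced_metric eps kap (screw rho t b) s theta h k =
  (h * r1) ^ 2 + sn kap (rho s) ^ 2 * k ^ 2 + eps * (h * t1 + b * k) ^ 2.
Proof.
intros Dr Dt.
rewrite (induced_metric_eq _ _ _ _ _ _ _ r1 0 0 1 t1 b); simpl.
- ring.
- exact Dr.
- auto_derive; auto.
- auto_derive; auto.
- auto_derive; auto.
- auto_derive; [now exists t1 | rewrite (is_derive_unique (fun z : R => t z) _ _ Dt); ring].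
- auto_derive; auto; ring.
Qed.

Definition bour_surface (eps m b : R) (rho t phi : R -> R) (x y : R) : cyl :=
  screw rho t b x (1 / m * y - eps * phi x).

Lemma induced_metric_bour_surface (eps kap m b : R) (rho t phi : R -> R)
  (x y h k r1 t1 p1 : R) :
  is_derive rho x r1 -> is_derive t x t1 -> is_derive phi x p1 ->
  induced_metric eps kap (bour_surface eps m b rho t phi) x y h k =
  (h * r1) ^ 2 + sn kap (rho x) ^ 2 * (k / m - eps * h * p1) ^ 2
  + eps * (h * t1 + b * (k / m - eps * h * p1)) ^ 2.
Proof.
intros Dr Dt Dp.
rewrite (induced_metric_eq _ _ _ _ _ _ _ r1 0 (- eps * p1) (/ m)
           (t1 - b * eps * p1) (b / m)); simpl.
- unfold Rdiv. ring.
- exact Dr.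
- auto_derive; auto.
- auto_derive; [now exists p1 | rewrite (is_derive_unique (fun z : R => phi z) _ _ Dp); ring].
- auto_derive; auto. unfold Rdiv. ring.
- auto_derive; [split; [now exists t1 | split; [now exists p1 | auto]] |].
  rewrite (is_derive_unique (fun z : R => phi z) _ _ Dp),
    (is_derive_unique (fun z : R => t z) _ _ Dt). ring.
- auto_derive; auto. unfold Rdiv. ring.
Qed.

(* The two radicands are related by [r1 ^ 2 = 1 - eps r ^ 2 / Q], which eliminates
   [u1] and [kap]. *)
Lemma bour_first_form (eps kap m b u u1 Q r1 r h k : R) :
  eps = 1 \/ eps = -1 -> m <> 0 -> u <> 0 ->
  Q = m ^ 2 * u ^ 2 - eps * b ^ 2 -> 0 < Q -> 0 < 1 - kap * Q ->
  r1 ^ 2 = m ^ 4 * u ^ 2 * u1 ^ 2 / (Q * (1 - kap * Q)) ->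
  r ^ 2 = eps * ((Q * (1 - kap * Q) - m ^ 4 * u ^ 2 * u1 ^ 2) / (1 - kap * Q)) ->
  let v := k / m - eps * h * (b / (m * u * Q) * r) in
  (h * r1) ^ 2 + Q * v ^ 2 + eps * (h * (r * (m * u / Q)) + b * v) ^ 2
  = h ^ 2 + u ^ 2 * k ^ 2.
Proof.
intros heps m0 u0 HQ Q0 c0 Hr1 Hr v. unfold v.
assert (e2 : eps * eps = 1) by (destruct heps; subst; ring).
assert (K : r1 ^ 2 = 1 - eps * r ^ 2 / Q).
{ rewrite Hr1, Hr.
  replace (eps * (eps * ((Q * (1 - kap * Q) - m ^ 4 * u ^ 2 * u1 ^ 2) / (1 - kap * Q))))
    with (eps * eps * ((Q * (1 - kap * Q) - m ^ 4 * u ^ 2 * u1 ^ 2) / (1 - kap * Q)))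
    by ring.
  rewrite e2. field. lra. }
rewrite Rpow_mult_distr, K. clear Hr Hr1 K c0.
rewrite HQ in *. destruct heps; subst eps; field; repeat split; auto; lra.
Qed.

(** Separates the formulas from the way their solutions are obtained, so that the original surface
    and the constructed ones share one metric computation. *)
Definition bour_data (eps kap : R) (U : R -> R) (J : R -> Prop) (m b : R)
  (rho t phi sgr sgt : R -> R) : Prop :=
  sign_on J sgr /\ sign_on J sgt /\
  forall x, J x ->
    is_derive rho x (sgr x * sqrt (rho_radicand eps kap U m b x)) /\
    is_derive t x
      (sgt x * sqrt (t_radicand eps kap U m b x) * (m * U x / bourQ eps U m b x)) /\
    is_derive phi x
      (b / (m * U x * bourQ eps U m b x) * (sgt x * sqrt (t_radicand eps kap U m b x))) /\
    sn kap (rho x) ^ 2 = bourQ eps U m b x.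

Lemma sign_sqrt_sq (z p : R) : z = 1 \/ z = -1 -> 0 <= p -> (z * sqrt p) ^ 2 = p.
Proof. intros [-> | ->] p0; rewrite Rpow_mult_distr, pow2_sqrt by exact p0; ring. Qed.

(** * First fundamental form of the surfaces given by the integral formulas *)

Section BourData.

Context (eps kap : R) (U : R -> R) (J : R -> Prop) (m b : R) (rho t phi sgr sgt : R -> R).
Hypothesis heps : eps = 1 \/ eps = -1.
Hypothesis U0 : forall x, J x -> U x <> 0.
Hypothesis adm : admissible eps kap U J m b.
Hypothesis data : bour_data eps kap U J m b rho t phi sgr sgt.

Lemma rho_radicand_ge0 (x : R) : J x -> 0 <= rho_radicand eps kap U m b x.
Proof.
intros Jx. destruct (proj2 adm x Jx) as (Q0 & c0 & _). unfold rho_radicand.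
apply Rdiv_le_0_compat; [|now apply Rmult_lt_0_compat].
replace (m ^ 4 * U x ^ 2 * Derive U x ^ 2) with ((m ^ 2 * U x * Derive U x) ^ 2) by ring.
apply pow2_ge_0.
Qed.

Lemma bour_data_first_form (x h k : R) : J x ->
  let r := sgt x * sqrt (t_radicand eps kap U m b x) in
  let v := k / m - eps * h * (b / (m * U x * bourQ eps U m b x) * r) in
  (h * (sgr x * sqrt (rho_radicand eps kap U m b x))) ^ 2 + sn kap (rho x) ^ 2 * v ^ 2
  + eps * (h * (r * (m * U x / bourQ eps U m b x)) + b * v) ^ 2
  = h ^ 2 + U x ^ 2 * k ^ 2.
Proof.
intros Jx r v. destruct data as (Hsgr & Hsgt & Hd).
destruct (Hd x Jx) as (_ & _ & _ & ->).
destruct adm as [m0 adm']. destruct (adm' x Jx) as (Q0 & c0 & R0).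
apply bour_first_form with (kap := kap) (u1 := Derive U x); auto.
- apply sign_sqrt_sq; [now apply Hsgr | now apply rho_radicand_ge0].
- apply sign_sqrt_sq; [now apply Hsgt | exact R0].
Qed.

Lemma induced_metric_bour_data (x y h k : R) : J x ->
  induced_metric eps kap (bour_surface eps m b rho t phi) x y h k = h ^ 2 + U x ^ 2 * k ^ 2.
Proof.
intros Jx. destruct (proj2 (proj2 data) x Jx) as (Dr & Dt & Dp & _).
rewrite (induced_metric_bour_surface _ _ _ _ _ _ _ _ _ _ _ _ _ _ Dr Dt Dp).
now apply bour_data_first_form.
Qed.

(** The vector (h, k) in the coordinates (x, theta) is the vector (h, k') in the natural ones, with
    k' = m (k + eps h phi'). There the form is h^2 + U^2 k'^2, which is positive definite. *)
Lemma bour_data_riemannian (x theta h k : R) : J x -> (h <> 0 \/ k <> 0) ->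
  0 < induced_metric eps kap (screw rho t b) x theta h k.
Proof.
intros Jx hk. destruct (proj2 (proj2 data) x Jx) as (Dr & Dt & _ & _).
rewrite (induced_metric_screw _ _ _ _ _ _ _ _ _ _ _ Dr Dt).
destruct adm as [m0 adm']. destruct (adm' x Jx) as (Q0 & _ & _).
assert (u0 := U0 x Jx).
set (r := sgt x * sqrt (t_radicand eps kap U m b x)).
set (p := b / (m * U x * bourQ eps U m b x) * r).
set (k' := m * (k + eps * h * p)).
assert (F := bour_data_first_form x h k' Jx). cbv zeta in F. fold r in F. fold p in F.
replace (k' / m - eps * h * p) with k in F by (unfold k'; now field).
rewrite F. rewrite <- Rpow_mult_distr.
destruct (Req_dec h 0) as [e|h0].
- destruct hk as [hk|k0]; [easy|].
  apply Rplus_le_lt_0_compat; [apply pow2_ge_0|]. apply pow2_gt_0.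
  unfold k'. rewrite e. replace (U x * (m * (k + eps * 0 * p))) with (U x * m * k) by ring.
  auto using Rmult_integral_contrapositive_currified.
- apply Rplus_lt_le_0_compat; [now apply pow2_gt_0 | apply pow2_ge_0].
Qed.

End BourData.

(** * The family of a helicoidal surface *)

Ltac class_C_arith :=
  try assumption;
  lazymatch goal with
  | |- class_C _ _ (fun _ => ?c) => apply class_C_const; try assumption
  | |- class_C _ _ (fun x => @?f x + @?g x) => apply (class_C_plus _ _ f g); class_C_arith
  | |- class_C _ _ (fun x => @?f x - @?g x) => apply (class_C_minus _ _ f g); class_C_arith
  | |- class_C _ _ (fun x => @?f x * @?g x) => apply (class_C_mult _ _ f g); class_C_arith
  | |- class_C _ _ (fun x => @?f x ^ ?k) => apply (class_C_pow _ _ f k); class_C_arith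
  | |- _ => idtac
  end.

Section BaseSurface.

Context (eps kap : R) (a1 a2 : Rbar) (rho0 t0 : R -> R) (b0 : R) (sig tau U : R -> R).
Hypothesis heps : eps = 1 \/ eps = -1.
Hypothesis hX0 : helicoidal eps kap 1 (itv a1 a2) rho0 t0 b0.
Hypothesis hnat : natural_parameters eps kap (itv a1 a2) rho0 t0 b0 sig tau U.

Let I := itv a1 a2.
Let pU := profile_U eps kap rho0 b0.
Let pW := profile_W eps kap rho0 t0 b0.

Lemma eps_sq : eps * eps = 1.
Proof. destruct heps; subst; ring. Qed.

Lemma base_derive (s : R) : I s ->
  is_derive rho0 s (Derive rho0 s) /\ is_derive t0 s (Derive t0 s).
Proof.
intros Is. destruct hX0 as (Cr & Ct & _).
split; eapply class_C_is_derive; eauto.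
Qed.

Lemma base_metric (s theta h k : R) : I s -> (h <> 0 \/ k <> 0) ->
  0 < (h * Derive rho0 s) ^ 2 + sn kap (rho0 s) ^ 2 * k ^ 2
      + eps * (h * Derive t0 s + b0 * k) ^ 2.
Proof.
intros Is hk. destruct (base_derive s Is) as [Dr Dt].
rewrite <- (induced_metric_screw eps kap rho0 t0 b0 s 0 h k _ _ Dr Dt).
now apply (proj2 (proj2 (proj2 hX0))).
Qed.

(** This is the squared length of the tangent vector (0, 1), the generator of the screw motion. *)
Lemma profile_U_radicand_pos (s : R) : I s -> 0 < sn kap (rho0 s) ^ 2 + eps * b0 ^ 2.
Proof.
intros Is. assert (K := base_metric s 0 0 1 Is (or_intror R1_neq_R0)). lra.
Qed.

Lemma profile_U_sq (s : R) : I s -> pU s ^ 2 = sn kap (rho0 s) ^ 2 + eps * b0 ^ 2.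
Proof. intros Is. apply pow2_sqrt. left. now apply profile_U_radicand_pos. Qed.

Lemma profile_U_pos (s : R) : I s -> 0 < pU s.
Proof. intros Is. now apply sqrt_lt_R0, profile_U_radicand_pos. Qed.

Lemma profile_W_radicand_pos (s : R) : I s ->
  0 < sn kap (rho0 s) ^ 2 * (Derive rho0 s ^ 2 + eps * Derive t0 s ^ 2)
      + eps * b0 ^ 2 * Derive rho0 s ^ 2.
Proof.
intros Is. assert (p := profile_U_radicand_pos s Is).
(* The metric takes its minimum over the vectors [(1, _)] at [(1, k)], where its value
   is W^2 / U^2. *)
set (k := - (eps * b0 * Derive t0 s) / (sn kap (rho0 s) ^ 2 + eps * b0 ^ 2)).
assert (K := base_metric s 0 1 k Is (or_introl R1_neq_R0)).
apply (Rmult_lt_compat_r _ _ _ p) in K. rewrite Rmult_0_l in K.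
apply Rlt_le_trans with (1 := K). right. unfold k.
assert (e := eps_sq). destruct heps; subst eps; field; lra.
Qed.

Lemma profile_W_sq (s : R) : I s ->
  pW s ^ 2 = pU s ^ 2 * Derive rho0 s ^ 2 + eps * sn kap (rho0 s) ^ 2 * Derive t0 s ^ 2.
Proof.
intros Is. unfold pW, profile_W. rewrite profile_U_sq by exact Is.
rewrite pow2_sqrt; [ring|]. left. now apply profile_W_radicand_pos.
Qed.

Lemma profile_W_pos (s : R) : I s -> 0 < pW s.
Proof. intros Is. now apply sqrt_lt_R0, profile_W_radicand_pos. Qed.

Lemma sn_rho0_pos (s : R) : I s -> 0 < sn kap (rho0 s).
Proof. intros Is. apply sn_pos. now apply (proj1 (proj2 (proj2 hX0))). Qed.

Lemma class_C_sn_rho0 (n : nat) : class_C n I rho0 -> class_C n I (fun s => sn kap (rho0 s)).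
Proof.
intros Cr. apply (class_C_comp n (fun _ => True) I); auto using open_true.
- apply open_itv.
- exact (proj1 (class_C_sn_cs n kap)).
Qed.

Lemma class_C_profile_U (n : nat) : class_C n I rho0 -> class_C n I pU.
Proof.
intros Cr. apply class_C_sqrt; [apply open_itv | exact profile_U_radicand_pos |].
apply class_C_plus; [apply open_itv | | apply class_C_const, open_itv].
apply class_C_pow; [apply open_itv | now apply class_C_sn_rho0].
Qed.

Lemma class_C_profile_W (n : nat) :
  class_C (S n) I rho0 -> class_C (S n) I t0 -> class_C n I pW.
Proof.
intros Cr Ct. apply class_C_sqrt; [apply open_itv | exact profile_W_radicand_pos |].
assert (Cr' := proj2 (proj1 (class_C_Derive _ _ _) Cr)).
assert (Ct' := proj2 (proj1 (class_C_Derive _ _ _) Ct)).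
assert (O := open_itv a1 a2 : open I).
assert (Cs := class_C_sn_rho0 n (class_C_pred _ _ _ Cr)).
class_C_arith.
Qed.

Lemma sig_derive_pos (s : R) : I s -> 0 < pW s / pU s.
Proof. intros Is. apply Rdiv_lt_0_compat; [now apply profile_W_pos | now apply profile_U_pos]. Qed.

Lemma is_derive_sig (s : R) : I s -> is_derive sig s (pW s / pU s).
Proof. intros Is. apply hnat, Is. Qed.

(** * Passing to the natural parameter *)

Context (c1 c2 : Rbar) (sinv : R -> R).
Let J := itv c1 c2.
Hypothesis sinvI : forall x, J x -> I (sinv x).
Hypothesis sig_sinv : forall x, J x -> sig (sinv x) = x.

(** A right inverse of the strictly increasing [sig] is also a left inverse. *)
Lemma sinv_sig (s : R) : I s -> J (sig s) -> sinv (sig s) = s.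
Proof.
intros Is Js.
apply (inj_on_itv a1 a2 sig (fun s => pW s / pU s)).
- exact is_derive_sig.
- exact sig_derive_pos.
- now apply sinvI.
- exact Is.
- now apply sig_sinv.
Qed.

Lemma is_derive_sinv (x : R) : J x -> is_derive sinv x (pU (sinv x) / pW (sinv x)).
Proof.
intros Jx. assert (Is := sinvI x Jx).
assert (u := profile_U_pos _ Is). assert (w := profile_W_pos _ Is).
eapply is_derive_eq.
- apply (is_derive_inverse a1 a2 J sig (fun s => pW s / pU s) sinv); auto.
  + apply open_itv.
  + exact is_derive_sig.
  + exact sig_derive_pos.
- cbv beta. field. split; lra.
Qed.

(** W costs one derivative of the profile, and the passage from sig' = W / U to [sig] regains it. *)
Lemma class_C_sinv (n : nat) :
  class_C (S n) I rho0 -> class_C (S n) I t0 -> class_C (S n) J sinv.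
Proof.
intros Cr Ct.
apply (class_C_inverse a1 a2 J sig (fun s => pW s / pU s) sinv); auto.
- apply open_itv.
- exact is_derive_sig.
- exact sig_derive_pos.
- apply class_C_div; [apply open_itv | | now apply class_C_profile_W
    | apply class_C_profile_U; now apply class_C_pred].
  intros s Is. assert (u := profile_U_pos s Is). lra.
Qed.

Lemma class_C_comp_sinv (n : nat) (f : R -> R) :
  class_C (S n) I rho0 -> class_C (S n) I t0 -> class_C (S n) I f ->
  class_C (S n) J (fun x => f (sinv x)).
Proof.
intros Cr Ct Cf. apply (class_C_comp _ I J f sinv).
- apply open_itv.
- apply open_itv.
- exact sinvI.
- exact Cf.
- now apply class_C_sinv.
Qed.

Lemma U_sinv (x : R) : J x -> U x = pU (sinv x).
Proof. intros Jx. rewrite <- (sig_sinv x Jx) at 1. now apply hnat, sinvI. Qed.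

Lemma U_pos (x : R) : J x -> 0 < U x.
Proof. intros Jx. rewrite U_sinv by exact Jx. now apply profile_U_pos, sinvI. Qed.

Lemma class_C_U (n : nat) :
  class_C (S n) I rho0 -> class_C (S n) I t0 -> class_C (S n) J U.
Proof.
intros Cr Ct.
apply (class_C_ext _ J (fun x => pU (sinv x))); [apply open_itv | |].
- intros. now rewrite U_sinv.
- apply class_C_comp_sinv; auto. now apply class_C_profile_U.
Qed.

(** Differentiating U^2 = sn(rho0)^2 + eps b0^2 along s = [sinv] x gives U U' = sn cs rho0' s', and
    s' = U / W cancels the factor U. *)
Lemma is_derive_U (x : R) : J x ->
  is_derive U x (sn kap (rho0 (sinv x)) * cs kap (rho0 (sinv x)) * Derive rho0 (sinv x)
                 / pW (sinv x)).
Proof.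
intros Jx. assert (Is := sinvI x Jx).
assert (u := profile_U_pos _ Is). assert (w := profile_W_pos _ Is).
apply (is_derive_ext_on J (fun x => pU (sinv x))); [apply open_itv | | exact Jx |].
{ intros. now rewrite U_sinv. }
eapply is_derive_eq.
{ apply (is_derive_comp pU sinv); [|now apply is_derive_sinv].
  apply (is_derive_sqrt (fun s => sn kap (rho0 s) ^ 2 + eps * b0 ^ 2));
    [|now apply profile_U_radicand_pos].
  apply (is_derive_plus (fun s => sn kap (rho0 s) ^ 2) (fun _ => eps * b0 ^ 2));
    [|apply is_derive_const].
  apply (is_derive_pow (fun s => sn kap (rho0 s)) 2).
  apply (is_derive_comp (sn kap) rho0); [apply is_derive_sn|].
  now apply base_derive. }
unfold scal, plus, zero; simpl. unfold mult; simpl.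
change (sqrt (sn kap (rho0 (sinv x)) * (sn kap (rho0 (sinv x)) * 1) + eps * (b0 * (b0 * 1))))
  with (pU (sinv x)).
field. split; lra.
Qed.

(** * The original surface satisfies the formulas for (1, b0) *)

Section OriginalSurface.

Let rho := fun x => rho0 (sinv x).
Let t := fun x => t0 (sinv x).
(** The original angle is y - tau, while the formula reads y / m - eps phi; since eps^2 = 1, this
    choice makes them agree at m = 1. *)
Let phi := fun x => eps * tau (sinv x).

Lemma bourQ_1 (x : R) : J x -> bourQ eps U 1 b0 x = sn kap (rho x) ^ 2.
Proof.
intros Jx. unfold bourQ. rewrite U_sinv, profile_U_sq by auto. unfold rho. ring.
Qed.

(** Here Q = sn^2 and 1 - kap Q = cs^2, so inserting U' = sn cs rho0' / W cancels both and leaves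
    (rho0' U / W)^2. *)
Lemma rho_radicand_1 (x : R) : J x -> 0 < 1 - kap * bourQ eps U 1 b0 x ->
  rho_radicand eps kap U 1 b0 x
  = (Derive rho0 (sinv x) * (pU (sinv x) / pW (sinv x))) ^ 2.
Proof.
intros Jx c0. assert (Is := sinvI x Jx).
assert (w := profile_W_pos _ Is). assert (p := sn_rho0_pos _ Is).
unfold rho_radicand. rewrite bourQ_1 in * by exact Jx.
rewrite (is_derive_unique _ _ _ (is_derive_U x Jx)).
rewrite <- cs_sn in *. unfold rho in *. rewrite U_sinv by exact Jx.
assert (cs kap (rho0 (sinv x)) <> 0) by (intros e; rewrite e in c0; lra).
field. repeat split; auto; lra.
Qed.

(** After cancelling cs^2 the radicand is eps sn^2 (W^2 - U^2 rho0'^2) / W^2, and W^2 - U^2 rho0'^2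
    = eps sn^2 t0'^2. The two factors eps then give 1. *)
Lemma t_radicand_1 (x : R) : J x -> 1 - kap * bourQ eps U 1 b0 x <> 0 ->
  t_radicand eps kap U 1 b0 x = (Derive t0 (sinv x) * (sn kap (rho x) ^ 2 / pW (sinv x))) ^ 2.
Proof.
intros Jx c0. assert (Is := sinvI x Jx).
assert (w := profile_W_pos _ Is). assert (w2 := profile_W_sq _ Is).
unfold t_radicand. rewrite bourQ_1 in * by exact Jx.
rewrite (is_derive_unique _ _ _ (is_derive_U x Jx)).
rewrite <- cs_sn in *. unfold rho in *. rewrite U_sinv by exact Jx.
assert (cs kap (rho0 (sinv x)) <> 0) by (intros e; rewrite e in c0; apply c0; ring).
set (S := sn kap (rho0 (sinv x))) in *. set (c := cs kap (rho0 (sinv x))) in *.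
set (dr := Derive rho0 (sinv x)) in *. set (dt := Derive t0 (sinv x)) in *.
set (W := pW (sinv x)) in *. set (u := pU (sinv x)) in *.
transitivity (eps * S ^ 2 * (W ^ 2 - u ^ 2 * dr ^ 2) / W ^ 2).
- field. split; [lra | auto].
- rewrite w2 at 1. assert (e := eps_sq).
  replace (eps * S ^ 2 * (u ^ 2 * dr ^ 2 + eps * S ^ 2 * dt ^ 2 - u ^ 2 * dr ^ 2))
    with (eps * eps * S ^ 4 * dt ^ 2) by ring.
  rewrite e. field. lra.
Qed.

(** The sign conditions come for free: 1 - kap Q = cs^2 is a square, so it is positive once nonzero,
    and the radicand of t is a square too. *)
Lemma admissible_1 :
  (forall x, J x -> 1 - kap * bourQ eps U 1 b0 x <> 0) -> admissible eps kap U J 1 b0.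
Proof.
intros c0. split; [exact R1_neq_R0|]. intros x Jx. specialize (c0 x Jx).
rewrite (t_radicand_1 x Jx c0). rewrite bourQ_1 in * by exact Jx.
assert (p := sn_rho0_pos _ (sinvI x Jx)). rewrite <- cs_sn in *. repeat split.
- now apply pow_lt.
- apply pow2_gt_0. intros e. rewrite e in c0. apply c0. ring.
- apply pow2_ge_0.
Qed.

(** The signs are those of rho0' and t0'. One sign serves both t and phi because tau' is a multiple
    of t0'. *)
Lemma original_bour_data : admissible eps kap U J 1 b0 ->
  bour_data eps kap U J 1 b0 rho t phi
    (fun x => sgn (Derive rho0 (sinv x) * (pU (sinv x) / pW (sinv x))))
    (fun x => sgn (Derive t0 (sinv x) * (sn kap (rho x) ^ 2 / pW (sinv x)))).
Proof.
intros [_ adm]. split; [|split]; [intros x _; apply sgn_cases .. |].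
intros x Jx. destruct (adm x Jx) as (Q0 & c0 & _).
assert (Is := sinvI x Jx).
assert (w := profile_W_pos _ Is). assert (u := profile_U_pos _ Is).
assert (p := sn_rho0_pos _ Is).
rewrite sgn_sqrt by now apply rho_radicand_1.
rewrite sgn_sqrt by (apply t_radicand_1; [exact Jx | lra]).
rewrite bourQ_1, U_sinv by exact Jx. unfold rho.
destruct (base_derive _ Is) as [Dr Dt].
split; [|split; [|split; [|reflexivity]]].
- eapply is_derive_eq.
  + apply (is_derive_comp rho0 sinv); [exact Dr | now apply is_derive_sinv].
  + apply Rmult_comm.
- eapply is_derive_eq.
  + apply (is_derive_comp t0 sinv); [exact Dt | now apply is_derive_sinv].
  + unfold scal; simpl. unfold mult; simpl. field. split; lra.
- eapply is_derive_eq.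
  + apply (is_derive_scal (fun x => tau (sinv x))).
    apply (is_derive_comp tau sinv); [apply hnat, Is | now apply is_derive_sinv].
  + unfold scal; simpl. unfold mult; simpl. fold pU.
    transitivity (eps * eps * b0 * Derive t0 (sinv x) / (pU (sinv x) * pW (sinv x))).
    * field. split; lra.
    * rewrite eps_sq. field. repeat split; lra.
Qed.

Lemma class_C_tau (n : nat) :
  class_C (S n) I rho0 -> class_C (S n) I t0 -> class_C (S n) I tau.
Proof.
intros Cr Ct.
apply (class_C_S n I _ (fun s => eps * b0 * Derive t0 s / pU s ^ 2)); [apply open_itv | |].
- intros s Is. now apply hnat.
- apply class_C_div; [apply open_itv | | |].
  + intros s Is. apply pow_nonzero. assert (u := profile_U_pos s Is). lra.
  + apply class_C_mult; [apply open_itv | apply class_C_const, open_itv |].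
    now apply class_C_Derive.
  + apply class_C_pow; [apply open_itv|]. apply class_C_profile_U. now apply class_C_pred.
Qed.

Lemma class_C_original (n : nat) :
  class_C (S n) I rho0 -> class_C (S n) I t0 ->
  class_C (S n) J rho /\ class_C (S n) J t /\ class_C (S n) J phi.
Proof.
intros Cr Ct. split; [|split]; [now apply class_C_comp_sinv .. |].
apply class_C_mult; [apply open_itv | apply class_C_const, open_itv |].
apply class_C_comp_sinv; auto. now apply class_C_tau.
Qed.

Lemma polar_radius_original (x : R) : J x -> polar_radius kap (rho x).
Proof. intros Jx. apply hX0, sinvI, Jx. Qed.

End OriginalSurface.

(** * Construction of a surface for given admissible (m, b) *)

Section Deformation.

Context (m b : R).
Hypothesis adm : admissible eps kap U J m b.

Let Q := bourQ eps U m b.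
(** The constant of integration is fixed by solving sn(rho)^2 = Q directly, on the branch where cs >
    0. *)
Let rho := fun x => arcsn kap (sqrt (Q x)).

Lemma sqrt_bourQ_range (x : R) : J x -> sn_range kap (sqrt (Q x)).
Proof.
intros Jx. destruct (proj2 adm x Jx) as (Q0 & c0 & _). split.
- now apply sqrt_lt_R0.
- rewrite pow2_sqrt; [exact c0 | now left].
Qed.

Lemma sn_deformation (x : R) : J x -> sn kap (rho x) ^ 2 = Q x.
Proof.
intros Jx. unfold rho. rewrite (proj2 (sn_arcsn _ _ (sqrt_bourQ_range x Jx))).
apply pow2_sqrt. left. now apply adm.
Qed.

Lemma polar_radius_deformation (x : R) : J x -> polar_radius kap (rho x).
Proof. intros Jx. apply polar_radius_quarter, sn_arcsn, sqrt_bourQ_range, Jx. Qed.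

Lemma is_derive_deformation_rho (x : R) : J x ->
  is_derive rho x (m ^ 2 * U x * Derive U x / (sqrt (Q x) * cs kap (rho x))).
Proof.
intros Jx. assert (r := sqrt_bourQ_range x Jx).
assert (c := cs_pos _ _ (proj1 (sn_arcsn _ _ r))).
assert (Q0 := proj1 (proj2 adm x Jx)). assert (q := sqrt_lt_R0 _ Q0). fold Q in q.
assert (DU : ex_derive U x) by (eexists; now apply is_derive_U).
eapply is_derive_eq.
- apply (is_derive_comp (arcsn kap) (fun x => sqrt (Q x))); [now apply is_derive_arcsn|].
  apply is_derive_sqrt; [|exact Q0]. unfold Q, bourQ. auto_derive; [exact DU | reflexivity].
- unfold scal; simpl. unfold mult; simpl. fold (rho x) in *.
  change (Derive (fun z => U z) x) with (Derive U x). field. split; lra.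
Qed.

Lemma deformation_rho_radicand (x : R) : J x ->
  rho_radicand eps kap U m b x
  = (m ^ 2 * U x * Derive U x / (sqrt (Q x) * cs kap (rho x))) ^ 2.
Proof.
intros Jx. assert (r := sqrt_bourQ_range x Jx).
assert (c := cs_pos _ _ (proj1 (sn_arcsn _ _ r))). fold (rho x) in c.
destruct (proj2 adm x Jx) as (Q0 & c0 & _). assert (q := sqrt_lt_R0 _ Q0).
unfold rho_radicand. fold Q in Q0, c0, q |- *.
(* The Q inside 1 - kap Q is replaced by sn(rho)^2 to produce cs^2; the other factor Q becomes the
   square of its root. *)
rewrite <- (sn_deformation x Jx) at 2. rewrite <- cs_sn.
rewrite <- (pow2_sqrt (Q x)) at 1 by (now left). field. split; lra.
Qed.

Lemma class_C_bourQ (n : nat) : class_C n J U -> class_C n J Q.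
Proof.
intros CU. apply class_C_minus; [apply open_itv | | apply class_C_const, open_itv].
apply class_C_mult; [apply open_itv | apply class_C_const, open_itv |].
now apply class_C_pow; [apply open_itv|].
Qed.

Lemma class_C_t_radicand (n : nat) :
  class_C (S n) J U -> class_C n J (t_radicand eps kap U m b).
Proof.
intros CU. assert (CU' := proj2 (proj1 (class_C_Derive _ _ _) CU)).
assert (CQ := class_C_bourQ n (class_C_pred _ _ _ CU)). unfold Q in CQ.
assert (O := open_itv c1 c2 : open J). assert (CU0 := class_C_pred _ _ _ CU).
unfold t_radicand.
apply class_C_mult; [exact O | now apply class_C_const |].
apply class_C_div; [exact O | | |].
- intros x Jx. apply Rgt_not_eq. now apply adm.
- class_C_arith.
- class_C_arith.
Qed.

(** The root is continuous even at zeros of the radicand, which settles class 0; differentiating it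
    requires positivity. *)
Lemma class_C_sqrt_t_radicand (n : nat) :
  class_C (S n) J U -> (n = 0%nat \/ forall x, J x -> 0 < t_radicand eps kap U m b x) ->
  class_C n J (fun x => sqrt (t_radicand eps kap U m b x)).
Proof.
intros CU [-> | p].
- apply class_C_0. intros x Jx. apply continuous_sqrt_comp.
  now apply (class_C_continuous 0 J); [apply class_C_t_radicand|].
- apply class_C_sqrt; [apply open_itv | exact p | now apply class_C_t_radicand].
Qed.

(** The factor 1 is the constant sign chosen for the root, kept visible to match the shape required
    by [bour_data]. *)
Let dt x := 1 * sqrt (t_radicand eps kap U m b x) * (m * U x / Q x).
Let dphi x := b / (m * U x * Q x) * (1 * sqrt (t_radicand eps kap U m b x)).

Lemma class_C_deformation_derivatives (n : nat) :
  class_C (S n) J U -> (n = 0%nat \/ forall x, J x -> 0 < t_radicand eps kap U m b x) ->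
  class_C n J dt /\ class_C n J dphi.
Proof.
intros CU p. assert (Cs := class_C_sqrt_t_radicand n CU p).
assert (CQ := class_C_bourQ n (class_C_pred _ _ _ CU)).
assert (O := open_itv c1 c2 : open J). assert (CU0 := class_C_pred _ _ _ CU).
assert (nQ : forall x, J x -> Q x <> 0) by (intros x Jx; apply Rgt_not_eq; now apply adm).
split.
- apply class_C_mult; [exact O | apply class_C_mult; auto using class_C_const |].
  apply class_C_div; auto. apply class_C_mult; auto using class_C_const.
- apply class_C_mult; [exact O | | apply class_C_mult; auto using class_C_const].
  apply class_C_div; auto using class_C_const.
  + intros x Jx. repeat apply Rmult_integral_contrapositive_currified; auto.
    * apply adm.
    * apply Rgt_not_eq. now apply U_pos.
  + class_C_arith.
Qed.

Lemma deformation_exists :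
  exists t phi,
    bour_data eps kap U J m b rho t phi
      (fun x => sgn (m ^ 2 * U x * Derive U x / (sqrt (Q x) * cs kap (rho x)))) (fun _ => 1) /\
    forall n, class_C (S n) I rho0 -> class_C (S n) I t0 ->
      (n = 0%nat \/ forall x, J x -> 0 < t_radicand eps kap U m b x) ->
      class_C (S n) J rho /\ class_C (S n) J t /\ class_C (S n) J phi.
Proof.
assert (CU : class_C 1 J U) by (apply class_C_U; apply hX0).
(* Continuity alone provides the primitives, before any [n] is given, so the same [t] and [phi]
   serve for every class. *)
destruct (class_C_deformation_derivatives 0 CU (or_introl eq_refl)) as [Ct Cp].
destruct (primitive_on_itv c1 c2 dt) as [t Dt].
{ intros x Jx. exact (class_C_continuous _ _ _ _ Ct Jx). }
destruct (primitive_on_itv c1 c2 dphi) as [phi Dp].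
{ intros x Jx. exact (class_C_continuous _ _ _ _ Cp Jx). }
exists t, phi. split; [split; [|split]|].
- intros x _. apply sgn_cases.
- intros x _. now left.
- intros x Jx. rewrite sgn_sqrt by now apply deformation_rho_radicand.
  split; [|split; [|split]].
  + now apply is_derive_deformation_rho.
  + now apply Dt.
  + now apply Dp.
  + now apply sn_deformation.
- intros n Cr Ct0 p. assert (CUn := class_C_U n Cr Ct0).
  destruct (class_C_deformation_derivatives n CUn p) as [Ctn Cpn].
  split; [|split].
  + apply (class_C_comp _ (sn_range kap) J (arcsn kap)).
    * apply open_sn_range.
    * apply open_itv.
    * exact sqrt_bourQ_range.
    * apply class_C_arcsn.
    * apply class_C_sqrt; [apply open_itv | intros x Jx; now apply adm |].
      now apply class_C_bourQ.
  + now apply (class_C_S n J t dt); [apply open_itv | |].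
  + now apply (class_C_S n J phi dphi); [apply open_itv | |].
Qed.

End Deformation.

(** What the theorem asserts of a single pair (m, b), isolated so that the family arises by choosing
    one parametrization per pair. *)
Definition isometric_member (m b : R) (Y : R -> R -> cyl) : Prop :=
  exists (rho t phi : R -> R) (theta : R -> R -> R) (sgr sgt : R -> R),
    sign_on J sgr /\ sign_on J sgt /\
    (forall x, J x ->
       is_derive rho x (sgr x * sqrt (rho_radicand eps kap U m b x)) /\
       is_derive t x
         (sgt x * sqrt (t_radicand eps kap U m b x) * (m * U x / bourQ eps U m b x)) /\
       is_derive phi x
         (b / (m * U x * bourQ eps U m b x)
          * (sgt x * sqrt (t_radicand eps kap U m b x))) /\
       (forall y, theta x y = 1 / m * y - eps * phi x) /\
       sn kap (rho x) ^ 2 = bourQ eps U m b x /\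
       (forall y, Y x y = Cyl (rho x) (theta x y) (t x + b * theta x y))) /\
    (forall n, (1 <= n)%nat ->
       helicoidal eps kap n I rho0 t0 b0 ->
       (n = 1%nat \/ forall x, J x -> 0 < t_radicand eps kap U m b x) ->
       helicoidal eps kap n J rho t b /\ class_C n J phi) /\
    (forall x y h k, J x -> induced_metric eps kap Y x y h k = h ^ 2 + U x ^ 2 * k ^ 2).

Lemma isometric_member_bour_surface (m b : R) (rho t phi sgr sgt : R -> R) :
  admissible eps kap U J m b ->
  bour_data eps kap U J m b rho t phi sgr sgt ->
  (forall x, J x -> polar_radius kap (rho x)) ->
  (forall n, class_C (S n) I rho0 -> class_C (S n) I t0 ->
     (n = 0%nat \/ forall x, J x -> 0 < t_radicand eps kap U m b x) ->
     class_C (S n) J rho /\ class_C (S n) J t /\ class_C (S n) J phi) ->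
  isometric_member m b (bour_surface eps m b rho t phi).
Proof.
intros adm data polar reg.
assert (U0 : forall x, J x -> U x <> 0) by (intros x Jx; now apply Rgt_not_eq, U_pos).
exists rho, t, phi, (fun x y => 1 / m * y - eps * phi x), sgr, sgt.
split; [apply data | split; [apply data |]].
split; [|split].
- intros x Jx. destruct (proj2 (proj2 data) x Jx) as (Dr & Dt & Dp & Hs).
  split; [exact Dr | split; [exact Dt | split; [exact Dp | split; [reflexivity |]]]].
  now split.
- intros n n1 (Cr & Ct & _) p.
  destruct n as [|q]; [lia|].
  assert (pq : q = 0%nat \/ forall x, J x -> 0 < t_radicand eps kap U m b x)
    by (destruct p; [left; lia | now right]).
  destruct (reg q Cr Ct pq) as (Cr' & Ct' & Cp').
  split; [|exact Cp']. split; [exact Cr' | split; [exact Ct' | split; [exact polar |]]].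
  intros x theta h k Jx hk.
  exact (bour_data_riemannian eps kap U J m b rho t phi sgr sgt heps U0 adm data
           x theta h k Jx hk).
- intros x y h k Jx.
  exact (induced_metric_bour_data eps kap U J m b rho t phi sgr sgt heps U0 adm data
           x y h k Jx).
Qed.

(* The original surface is taken as it stands for [(m, b) = (1, b0)]: there [rho0] need
   not be the value [arcsn (sqrt Q)] chosen for the other parameters. *)
Lemma isometric_family (m b : R) :
  exists Y : R -> R -> cyl,
    (m = 1 -> b = b0 -> forall s theta, I s -> J (sig s) ->
       Y (sig s) (theta + tau s) = screw rho0 t0 b0 s theta) /\
    (admissible eps kap U J m b -> isometric_member m b Y).
Proof.
destruct (classic (m = 1 /\ b = b0)) as [[-> ->]|N].
- eexists. split; [|intros adm].
  2: { eapply isometric_member_bour_surface; [exact adm | now apply original_bour_data | |].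
       - exact polar_radius_original.
       - intros n Cr Ct _. now apply class_C_original. }
  intros _ _ s theta Is Js. unfold bour_surface, screw. rewrite sinv_sig by assumption.
  replace (1 / 1 * (theta + tau s) - eps * (eps * tau s))
    with (theta + tau s - eps * eps * tau s) by field.
  rewrite eps_sq. f_equal; ring.
- destruct (classic (admissible eps kap U J m b)) as [adm|nadm].
  + destruct (deformation_exists m b adm) as (t & phi & D & C).
    eexists. split; [intros; tauto|]. intros _.
    eapply isometric_member_bour_surface; [exact adm | exact D | | exact C].
    now apply polar_radius_deformation.
  (* A default value: nothing is claimed at a non-admissible pair other than (1, b0). *)
  + exists (fun _ _ => Cyl 0 0 0). split; [intros|]; tauto.
Qed.

End BaseSurface.

Theorem theorem1
  (eps kap : R) (heps : eps = 1 \/ eps = -1)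
  (a1 a2 : Rbar) (rho0 t0 : R -> R) (b0 : R)
  (hX0 : helicoidal eps kap 1 (itv a1 a2) rho0 t0 b0)
  (sig tau U : R -> R)
  (hnat : natural_parameters eps kap (itv a1 a2) rho0 t0 b0 sig tau U)
  (c1 c2 : Rbar) (hJ : Rbar_lt c1 c2)
  (hJsig : forall x, itv c1 c2 x -> exists s, itv a1 a2 s /\ sig s = x) :
  exists X : R -> R -> R -> R -> cyl,
    (forall s theta, itv a1 a2 s -> itv c1 c2 (sig s) ->
       X 1 b0 (sig s) (theta + tau s) = screw rho0 t0 b0 s theta) /\
    ((forall x, itv c1 c2 x -> 1 - kap * bourQ eps U 1 b0 x <> 0) ->
       admissible eps kap U (itv c1 c2) 1 b0) /\
    (forall m b, admissible eps kap U (itv c1 c2) m b ->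
       exists (rho t phi : R -> R) (theta : R -> R -> R) (sgr sgt : R -> R),
         sign_on (itv c1 c2) sgr /\ sign_on (itv c1 c2) sgt /\
         (forall x, itv c1 c2 x ->
            is_derive rho x (sgr x * sqrt (rho_radicand eps kap U m b x)) /\
            is_derive t x
              (sgt x * sqrt (t_radicand eps kap U m b x)
               * (m * U x / bourQ eps U m b x)) /\
            is_derive phi x
              (b / (m * U x * bourQ eps U m b x)
               * (sgt x * sqrt (t_radicand eps kap U m b x))) /\
            (forall y, theta x y = 1 / m * y - eps * phi x) /\
            sn kap (rho x) ^ 2 = bourQ eps U m b x /\
            (forall y, X m b x y = Cyl (rho x) (theta x y) (t x + b * theta x y))) /\
         (forall n, (1 <= n)%nat ->
            helicoidal eps kap n (itv a1 a2) rho0 t0 b0 ->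
            (n = 1%nat \/
             forall x, itv c1 c2 x -> 0 < t_radicand eps kap U m b x) ->
            helicoidal eps kap n (itv c1 c2) rho t b /\
            class_C n (itv c1 c2) phi) /\
         (forall x y h k, itv c1 c2 x ->
            induced_metric eps kap (X m b) x y h k = h ^ 2 + U x ^ 2 * k ^ 2)).
Proof.
(* Membership in the interval is moved under the existential so that choice gives a total function;
   outside, x itself is the default. *)
assert (chi : forall x, exists s, itv c1 c2 x -> itv a1 a2 s /\ sig s = x).
{ intros x. destruct (classic (itv c1 c2 x)) as [Jx|nJx].
  - destruct (hJsig x Jx) as [s Hs]. now exists s.
  - now exists x. }
set (sinv := fun x => proj1_sig (constructive_indefinite_description _ (chi x))).
assert (Hsinv : forall x, itv c1 c2 x -> itv a1 a2 (sinv x) /\ sig (sinv x) = x).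
{ intros x. exact (proj2_sig (constructive_indefinite_description _ (chi x))). }
assert (sinvI := fun x Jx => proj1 (Hsinv x Jx)).
assert (sig_sinv := fun x Jx => proj2 (Hsinv x Jx)).
set (F := isometric_family eps kap a1 a2 rho0 t0 b0 sig tau U heps hX0 hnat
            c1 c2 sinv sinvI sig_sinv).
(* The premises m = 1 and b = b0 inside [isometric_family] let one uniform choice carry both the
   identity with the original surface and the isometry. *)
exists (fun m b => proj1_sig (constructive_indefinite_description _ (F m b))).
split; [|split].
- intros s theta Is Js.
  exact (proj1 (proj2_sig (constructive_indefinite_description _ (F 1 b0)))
           eq_refl eq_refl s theta Is Js).
- exact (admissible_1 eps kap a1 a2 rho0 t0 b0 sig tau U heps hX0 hnat
           c1 c2 sinv sinvI sig_sinv).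
- intros m b adm.
  exact (proj2 (proj2_sig (constructive_indefinite_description _ (F m b))) adm).
Qed.
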